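(* For every closed $\lambda$-term $M_0$, the readback of the initial configuration $\langle M_0,\varnothing,\varnothing\rangle$ equals its L\'evy--Longo tree $\mathrm{LLT}(M_0)$.
   Context: **$\lambda$-calculus.** Terms $M::=x\mid\lambda x.M\mid M_1\,M_2$. Weak-head reduction contracts the leftmost $\beta$-redex along the function spine, without reducing under an abstraction: $(\lambda x.e)\,v\,M_1\cdots M_k\to_h e[v/x]\,M_1\cdots M_k$. A weak head normal form (WHNF) is a term with no weak-head redex: an abstraction $\lambda x.M'$ or an application $y\,M_1\cdots M_k$ headed by a variable. The L\'evy--Longo tree $\mathrm{LLT}(M)$ is the hereditary weak head normal form of $M$: expose the top constructor of the WHNF, recurse into the immediate sub-terms, and place $\bot$ where no WHNF is reached. That is, $\mathrm{LLT}(M)=\bot$ if $M$ has no WHNF; a node $\lambda x$ over $\mathrm{LLT}(M')$ if the WHNF is $\lambda x.M'$; a node headed by $y$ with arguments $\mathrm{LLT}(M_1),\dots,\mathrm{LLT}(M_k)$ if the WHNF is $y\,M_1\cdots M_k$. **Translation and shapes.** $M_0$ is translated into a document of inheritance-calculus (a tree whose nodes are reached by paths, i.e. finite sequences of labels; $\frown$ is concatenation and $()$ the root). Variable names are labels, disjoint from the labels \texttt{\_\_whnf}, \texttt{\_\_parameter}, \texttt{\_\_result}, \texttt{\_\_call}, \texttt{\_\_callee}. A variable $x$ becomes a node with the single reference $[x]$. An abstraction $\lambda x.M$ becomes a node with the single definition \texttt{\_\_whnf}, whose body (the abstraction shape) defines the alias label $x$ (body: the reference $[\texttt{\_\_parameter}]$),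 \texttt{\_\_parameter} (empty body) and \texttt{\_\_result} (body: the translation of $M$). An application $M_1\,M_2$ becomes a node defining \texttt{\_\_callee} (body: the translation of $M_1$), \texttt{\_\_call} (body: the reference $[\texttt{\_\_callee},\texttt{\_\_whnf}]$ and a definition of \texttt{\_\_parameter} by the translation of $M_2$) and \texttt{\_\_whnf} (body: the reference $[\texttt{\_\_call},\texttt{\_\_result},\texttt{\_\_whnf}]$). **Open Krivine machine with focus paths.** Fix a closed $M_0$. A configuration is $\langle u,\rho,S\rangle$ together with a focus path $\pi$: $u$ is an occurrence of a subterm of $M_0$; the environment $\rho$ maps each free variable of $u$ either to a closure (a pair of a subterm occurrence and its own environment, which carries a thunk path) or to a declaration entry (a path $\pi'\frown(\texttt{\_\_whnf},\texttt{\_\_parameter})$ of a parameter-declaration instance, carrying no term and no environment); the stack $S$ is a finite list of closures. The initial configuration $\langle M_0,\varnothing,\varnothing\rangle$ has focus $()$. Transitions: - push: $\langle u_1u_2,\rho,S\rangle\to\langle u_1,\rho,(u_2,\rho)\cdot S\rangle$; the new closure has thunk path $\pi\frown(\texttt{\_\_call},\texttt{\_\_parameter})$, the new focus is $\pi\frown(\texttt{\_\_callee})$; - $\beta$: $\langle\lambda x.u',\rho,c\cdot S\rangle\to\langle u',\rho[x\mapsto c],S\rangle$; if $c$ has thunk path $\alpha\frown(\texttt{\_\_call},\texttt{\_\_parameter})$, the new focus is $\alpha\frown(\texttt{\_\_call},\texttt{\_\_result})$; - lookup: if $\rho(x)=(u',\rho')$ is a closure, $\langle x,\rho,S\rangle\to\langle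 u',\rho',S\rangle$, with new focus the thunk path of $\rho(x)$; - enter (not an evaluation step but one navigation step of the tree): an abstraction under the empty stack, $\langle\lambda x.u',\rho,\varnothing\rangle$ with focus $\pi$, passes to $\langle u',\rho[x\mapsto\pi\frown(\texttt{\_\_whnf},\texttt{\_\_parameter})],\varnothing\rangle$ with focus $\pi\frown(\texttt{\_\_whnf},\texttt{\_\_result})$; - block: a configuration whose control is a variable $x$ with $\rho(x)$ a declaration entry is terminal; it is called a head-variable configuration, and the closures on its stack are, in order, the arguments of the head variable. A run from a configuration has exactly three outcomes: halting (an abstraction under the empty stack), blocking (a head-variable configuration), or non-termination. **Observation and readback.** The observation of a reachable configuration $K$ is: shape (the run halts), head variable (the run blocks), or $\bot$ (non-termination). The readback is defined recursively: - observation shape: $\lambda x$ over the readback of the configuration after the enter step, where $x$ is the alias label of the shape; - observation head variable: the application spine headed by the blocked variable $y$, whose arguments are the readbacks of the configurations taking, in order, each stacked closure as control and focus under the empty stack; - observation $\bot$: the readback is $\bot$.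
   Formalization: Equality is up to bound names, and readback names a binder or head variable by its alias label together with its declaration path; with alias labels alone the claim fails for (λd. d d)(λf.λx. f x), read back as λx.λx. x x instead of λx.λy. x y. *)

(* Defs.v *)
From Stdlib Require Import Relation_Operators ClassicalEpsilon.
From mathcomp Require Import all_boot.

Set Implicit Arguments.
Unset Strict Implicit.
Unset Printing Implicit Defensive.

Definition name := nat.

Inductive term : Type :=
| Var (x : name)
| Lam (x : name) (M : term)
| App (M N : term).

Fixpoint fv (M : term) : seq name :=
  match M with
  | Var x => [:: x]
  | Lam x M' => [seq y <- fv M' | y != x]
  | App M1 M2 => fv M1 ++ fv M2
  end.

Definition closed_term (M : term) : Prop := fv M = [::].

Definition apps (M : term) (Ns : seq term) : term := foldl App M Ns.

Definition upd (s : name -> term) (x : name) (N : term) : name -> term :=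
  fun y => if y == x then N else s y.

Definition fresh (xs : seq name) : name := (foldr maxn 0 xs).+1.

(* Capture-avoiding simultaneous substitution: every binder crossed is renamed
   to a name that is free in no term substituted below it.  The recursion is
   structural because the renaming is part of the substitution. *)
Fixpoint subst (s : name -> term) (M : term) : term :=
  match M with
  | Var x => s x
  | App M1 M2 => App (subst s M1) (subst s M2)
  | Lam x M' =>
      let z := fresh (flatten [seq fv (s y) | y <- fv (Lam x M')]) in
      Lam z (subst (upd s x (Var z)) M')
  end.

Definition subst1 (e : term) (x : name) (v : term) : term :=
  subst (upd Var x v) e.

Inductive wh_step : term -> term -> Prop :=
| WhBeta x e v Ms :
    wh_step (apps (App (Lam x e) v) Ms) (apps (subst1 e x v) Ms).

Definition wh_red : term -> term -> Prop := clos_refl_trans term wh_step.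

Inductive whnf : term -> Prop :=
| WhnfLam x M : whnf (Lam x M)
| WhnfVar y Ms : whnf (apps (Var y) Ms).

CoInductive tree (V : Type) : Type :=
| TBot
| TLam (x : V) (t : tree V)
| THead (y : V) (k : nat) (args : 'I_k -> tree V).
Arguments TBot {V}.

(* One layer of a tree, over states [S] from which the sub-trees are grown. *)
Variant view (S V : Type) : Type :=
| VBot
| VLam (x : V) (s : S)
| VHead (y : V) (ss : seq S).
Arguments VBot {S V}.
Arguments VLam {S V}.
Arguments VHead {S V}.

CoFixpoint unfold_tree (S V : Type) (top : S -> view S V) (s : S) : tree V :=
  match top s with
  | VBot => TBot
  | VLam x s' => TLam x (unfold_tree top s')
  | VHead y ss =>
      THead y (fun i : 'I_(size ss) => unfold_tree top (tnth (in_tuple ss) i))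
  end.

(* [binds E v w]: looking outwards through the pairs of binders crossed so far
   (innermost first), [v] and [w] are bound by the same pair. *)
Fixpoint binds (V W : Type) (E : seq (V * W)) (v : V) (w : W) : Prop :=
  match E with
  | [::] => False
  | (v', w') :: E' =>
      (v = v' /\ w = w') \/ (v <> v' /\ w <> w' /\ binds E' v w)
  end.

(* Equality of trees up to the choice of bound names; with [E] empty it relates
   closed trees only.  The two trees may draw their names from different
   types. *)
CoInductive alpha_eq (V W : Type) : seq (V * W) -> tree V -> tree W -> Prop :=
| AeqBot E : alpha_eq E TBot TBot
| AeqLam E x y t u :
    alpha_eq ((x, y) :: E) t u -> alpha_eq E (TLam x t) (TLam y u)
| AeqHead E v w k (f : 'I_k -> tree V) (g : 'I_k -> tree W) :
    binds E v w -> (forall i, alpha_eq E (f i) (g i)) ->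
    alpha_eq E (THead v f) (THead w g).

Inductive exposes : term -> view term name -> Prop :=
| ExpLam M x M' : wh_red M (Lam x M') -> exposes M (VLam x M')
| ExpHead M y Ms : wh_red M (apps (Var y) Ms) -> exposes M (VHead y Ms)
| ExpBot M : ~ (exists N, wh_red M N /\ whnf N) -> exposes M VBot.

(* [exposes] is total and functional, so [epsilon] only turns it into a
   function. *)
Definition LLT : term -> tree name :=
  unfold_tree (fun M => epsilon (inhabits VBot) (exposes M)).

Inductive label : Type :=
| LVar (x : name)
| Lwhnf
| Lparameter
| Lresult
| Lcall
| Lcallee.

Definition lpath := seq label.

Inductive closure : Type :=
| Clo (u : term) (rho : env) (thunk : lpath)
with env : Type :=
| Empty
| Bind (rho : env) (x : name) (e : entry)
with entry : Type :=
| EClo (c : closure)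
| EDecl (d : lpath).

Definition thunk_path (c : closure) : lpath := let: Clo _ _ t := c in t.

Fixpoint lookup (rho : env) (x : name) : option entry :=
  match rho with
  | Empty => None
  | Bind rho' y e => if x == y then Some e else lookup rho' x
  end.

Record config : Type := Config {
  control : term;
  environment : env;
  stack : seq closure;
  focus : lpath
}.

Definition initial (M0 : term) : config := Config M0 Empty [::] [::].

Inductive step : config -> config -> Prop :=
| StepPush u1 u2 rho S pi :
    step (Config (App u1 u2) rho S pi)
         (Config u1 rho (Clo u2 rho (pi ++ [:: Lcall; Lparameter]) :: S)
                 (pi ++ [:: Lcallee]))
| StepBeta x u rho c S pi alpha :
    thunk_path c = alpha ++ [:: Lcall; Lparameter] ->
    step (Config (Lam x u) rho (c :: S) pi)
         (Config u (Bind rho x (EClo c)) S (alpha ++ [:: Lcall; Lresult]))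
| StepLookup x rho S pi u' rho' t :
    lookup rho x = Some (EClo (Clo u' rho' t)) ->
    step (Config (Var x) rho S pi) (Config u' rho' S t).

Definition run : config -> config -> Prop := clos_refl_trans config step.

Definition diverges (K : config) : Prop :=
  exists r : nat -> config, r 0 = K /\ forall n, step (r n) (r n.+1).

Definition decl_path (pi : lpath) : lpath := pi ++ [:: Lwhnf; Lparameter].

(* The configuration after the enter step from [<Lam x u, rho, []>] at [pi]. *)
Definition entered (x : name) (u : term) (rho : env) (pi : lpath) : config :=
  Config u (Bind rho x (EDecl (decl_path pi))) [::] (pi ++ [:: Lwhnf; Lresult]).

Definition focus_on (c : closure) : config :=
  let: Clo u rho t := c in Config u rho [::] t.

(* A source binder may be entered several times along one branch of the
   readback, so its name alone does not say which of these instances a blocked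
   variable refers to; the declaration entry found in the environment does.
   The readback therefore names a variable by its alias label together with
   the path of its declaration instance. *)
Definition instance : Type := (name * lpath)%type.

Inductive observes : config -> view config instance -> Prop :=
| ObsShape K x u rho pi :
    run K (Config (Lam x u) rho [::] pi) ->
    observes K (VLam (x, decl_path pi) (entered x u rho pi))
| ObsHead K y rho S pi d :
    run K (Config (Var y) rho S pi) ->
    lookup rho y = Some (EDecl d) ->
    observes K (VHead (y, d) [seq focus_on c | c <- S])
| ObsBot K : diverges K -> observes K VBot.

(* [observes] is functional, and total on the configurations reachable from the
   initial configuration of a closed term; elsewhere (unbound control variable,
   ill-formed thunk path) the machine may be stuck and the value of [readback]
   is meaningless. *)
Definition readback : config -> tree instance :=
  unfold_tree (fun K => epsilon (inhabits VBot) (observes K)).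

(* Main.v *)
From Stdlib Require Import Relation_Operators Operators_Properties.
From Stdlib Require Import Classical ClassicalEpsilon.
From HB Require Import structures.
From mathcomp Require Import all_boot zify.
(* Last, because fingraph also defines a notation [closure]. *)
Require Import Defs.

(** A configuration decodes to a de Bruijn term: substitute the closures of its
environment, apply to its stack, and let a declaration entry stand for the
index of its instance among the enter steps made so far.  Push and lookup keep
the decoded term and make the configuration smaller; beta is one weak-head
step.  So a configuration and a named term with the same de Bruijn image have
the same observation, and the states below them are related again.

What needs care is that an enter step at focus [pi] does not capture an
instance already present in the environment.  A focus path determines the
subterm and the environment it is paired with (relation [node]).  If the
environment [rho] of an abstraction at [pi] contained the declaration instance
of [pi], that instance would have been created at [pi] too, hence in the same
environment [rho], and [rho] would contain itself. *)

Set Implicit Arguments.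
Unset Strict Implicit.
Unset Printing Implicit Defensive.

(** * De Bruijn terms *)

Inductive db : Type :=
| DVar (n : nat)
| DLam (t : db)
| DApp (t1 t2 : db).

Definition upr (f : nat -> nat) (n : nat) : nat := if n is m.+1 then (f m).+1 else 0.

Fixpoint ren (f : nat -> nat) (t : db) : db :=
  match t with
  | DVar n => DVar (f n)
  | DLam t' => DLam (ren (upr f) t')
  | DApp t1 t2 => DApp (ren f t1) (ren f t2)
  end.

Definition ups (s : nat -> db) (n : nat) : db := if n is m.+1 then ren succn (s m) else DVar 0.

Fixpoint inst (s : nat -> db) (t : db) : db :=
  match t with
  | DVar n => s n
  | DLam t' => DLam (inst (ups s) t')
  | DApp t1 t2 => DApp (inst s t1) (inst s t2)
  end.

Definition scons (t : db) (n : nat) : db := if n is m.+1 then DVar m else t.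

Definition dapps (t : db) (ts : seq db) : db := foldl DApp t ts.

Lemma inst_ext s1 s2 t : s1 =1 s2 -> inst s1 t = inst s2 t.
Proof.
elim: t s1 s2 => [n|t IH|t1 IH1 t2 IH2] s1 s2 e /=; first exact: e.
- by congr DLam; apply: IH => -[|n] //=; rewrite e.
- by rewrite (IH1 _ _ e) (IH2 _ _ e).
Qed.

Lemma inst_DVar t : inst DVar t = t.
Proof.
elim: t => [n|t IH|t1 IH1 t2 IH2] //=; last by rewrite IH1 IH2.
by rewrite -[in RHS]IH; congr DLam; apply: inst_ext => -[|n].
Qed.

Lemma ren_inst f t : ren f t = inst (fun n => DVar (f n)) t.
Proof.
elim: t f => [n|t IH|t1 IH1 t2 IH2] f //=; last by rewrite IH1 IH2.
by rewrite IH; congr DLam; apply: inst_ext => -[|n].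
Qed.

Lemma inst_ren s f t : inst s (ren f t) = inst (fun n => s (f n)) t.
Proof.
elim: t s f => [n|t IH|t1 IH1 t2 IH2] s f //=; last by rewrite IH1 IH2.
by rewrite IH; congr DLam; apply: inst_ext => -[|n].
Qed.

Lemma ren_ren f g t : ren f (ren g t) = ren (fun n => f (g n)) t.
Proof. by rewrite ren_inst inst_ren -ren_inst. Qed.

Lemma ren_inst_comp f s t : ren f (inst s t) = inst (fun n => ren f (s n)) t.
Proof.
elim: t s f => [n|t IH|t1 IH1 t2 IH2] s f //=; last by rewrite IH1 IH2.
by rewrite IH; congr DLam; apply: inst_ext => -[|n] //=; rewrite !ren_ren.
Qed.

Lemma inst_ups_shift s t : inst (ups s) (ren succn t) = ren succn (inst s t).
Proof. by rewrite inst_ren ren_inst_comp. Qed.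

(** * Translation of named terms *)

Definition up (s : name -> db) (x y : name) : db := if y == x then DVar 0 else ren succn (s y).

(** Names go to arbitrary de Bruijn terms, not just indices, so that one function both translates
    named terms (under [vars]) and decodes machine terms (under [dec_env]). *)
Fixpoint tr (s : name -> db) (M : term) : db :=
  match M with
  | Var x => s x
  | Lam x M' => DLam (tr (up s x) M')
  | App M1 M2 => DApp (tr s M1) (tr s M2)
  end.

Lemma tr_ext s1 s2 M : {in fv M, s1 =1 s2} -> tr s1 M = tr s2 M.
Proof.
elim: M s1 s2 => [x|x M IH|M1 IH1 M2 IH2] s1 s2 e /=.
- by apply: e; rewrite mem_head.
- congr DLam; apply: IH => y yM; rewrite /up; case: eqP => // /eqP yx.
  by rewrite e // mem_filter yx.
- by rewrite (IH1 s1 s2) 1?(IH2 s1 s2) // => y yM; apply: e; rewrite mem_cat yM ?orbT.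
Qed.

Lemma inst_tr sg s M : inst sg (tr s M) = tr (fun y => inst sg (s y)) M.
Proof.
elim: M sg s => [x|x M IH|M1 IH1 M2 IH2] sg s //=; last by rewrite IH1 IH2.
rewrite IH; congr DLam; apply: tr_ext => y _; rewrite /up.
by case: eqP => // _; rewrite inst_ups_shift.
Qed.

Lemma ren_tr f s M : ren f (tr s M) = tr (fun y => ren f (s y)) M.
Proof. by rewrite ren_inst inst_tr; apply: tr_ext => y _; rewrite ren_inst. Qed.

Lemma inst_scons_tr t s x M :
  inst (scons t) (tr (up s x) M) = tr (fun y => if y == x then t else s y) M.
Proof.
rewrite inst_tr; apply: tr_ext => y _; rewrite /up.
by case: eqP => // _; rewrite inst_ren inst_DVar.
Qed.

Lemma fresh_notin xs : fresh xs \notin xs.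
Proof.
have le x : x \in xs -> x <= foldr maxn 0 xs.
  elim: xs => //= y xs IH; rewrite inE => /orP [/eqP ->|/IH]; lia.
by apply/negP => /le; rewrite /fresh ltnn.
Qed.

(** Renaming is invisible in the image: the binder [z] chosen by [subst] is free in no term
    substituted below it, so passing under it only shifts their images. *)
Lemma tr_subst s sg M : tr s (subst sg M) = tr (fun y => tr s (sg y)) M.
Proof.
elim: M s sg => [x|x M IH|M1 IH1 M2 IH2] s sg //; last by rewrite /= IH1 IH2.
cbn [subst tr]; set z := fresh _.
have zP : z \notin _ := fresh_notin _.
rewrite IH; congr DLam; apply: tr_ext => y yM; rewrite /upd [RHS]/up.
case: eqP => [_|/eqP yx] /=; first by rewrite /up eqxx.
rewrite ren_tr; apply: tr_ext => w ws; rewrite /up; case: eqP => // wz.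
case/negP: zP; rewrite -wz; apply/flattenP; exists (fv (sg y)) => //.
by apply: (map_f (fun y => fv (sg y))); rewrite mem_filter yx.
Qed.

Lemma tr_subst1 s e x v :
  tr s (subst1 e x v) = inst (scons (tr s v)) (tr (up s x) e).
Proof.
rewrite inst_scons_tr tr_subst; apply: tr_ext => y _; rewrite /upd.
by case: eqP.
Qed.

(** [index] stops at the innermost binder of a name, which resolves shadowing; names outside [N] all
    get [size N]. *)
Definition vars (N : seq name) (x : name) : db := DVar (index x N).

Lemma up_vars x N : up (vars N) x =1 vars (x :: N).
Proof. by move=> y; rewrite /up /vars /= eq_sym; case: eqP. Qed.

Lemma tr_vars_cons x N M : tr (up (vars N) x) M = tr (vars (x :: N)) M.
Proof. by apply: tr_ext => y _; rewrite up_vars. Qed.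

(** [vars] yields only variables, so an application in the image comes from an application. This
    reads a redex or a head form of [M] off a decoded configuration. *)
Lemma tr_dapps_inv N M t ts :
  tr (vars N) M = dapps t ts ->
  exists M' Ms, [/\ M = apps M' Ms, tr (vars N) M' = t & [seq tr (vars N) P | P <- Ms] = ts].
Proof.
elim/last_ind: ts M => [|ts t' IH] M; first by exists M, [::].
rewrite /dapps -cats1 foldl_cat /=; case: M => //= M1 M2 [/IH [M' [Ms [-> e1 e2]]] e3].
exists M', (rcons Ms M2); split=> //; first by rewrite /apps -cats1 foldl_cat.
by rewrite map_rcons e2 e3 cats1.
Qed.

(** * Weak-head reduction *)

Lemma wh_red1n M N : wh_red M N -> clos_refl_trans_1n term wh_step M N.
Proof. exact: clos_rt_rt1n. Qed.

Lemma wh_red_of1n M N : clos_refl_trans_1n term wh_step M N -> wh_red M N.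
Proof. exact: clos_rt1n_rt. Qed.

Lemma apps_rcons M Ms N : apps M (rcons Ms N) = App (apps M Ms) N.
Proof. by rewrite /apps -cats1 foldl_cat. Qed.

Lemma apps_Var_inj y z Ms Ns :
  apps (Var y) Ms = apps (Var z) Ns -> y = z /\ Ms = Ns.
Proof.
elim/last_ind: Ms Ns => [|Ms M IH]; elim/last_ind => [|Ns N _];
  rewrite ?apps_rcons //=; first by case.
by case=> /IH [-> ->] ->.
Qed.

Lemma apps_Var_Lam y Ms x M : apps (Var y) Ms <> Lam x M.
Proof. by elim/last_ind: Ms => [|Ms N _]; rewrite ?apps_rcons. Qed.

(** The functional form of [wh_step]: determinism becomes equality of values, and weak head normal
    forms have value [None]. *)
Fixpoint wh_next (M : term) : option term :=
  match M with
  | App (Lam x e) v => Some (subst1 e x v)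
  | App M1 M2 => omap (App^~ M2) (wh_next M1)
  | _ => None
  end.

Lemma wh_step_next M M' : wh_step M M' -> wh_next M = Some M'.
Proof.
case=> x e v Ms; elim/last_ind: Ms => //= Ms N IH; rewrite !apps_rcons /= IH.
by case: (lastP Ms) => [|? ?]; rewrite ?apps_rcons.
Qed.

Lemma whnf_next M : whnf M -> wh_next M = None.
Proof.
case=> // y Ms; elim/last_ind: Ms => //= Ms N; rewrite apps_rcons /= => ->.
by case: (lastP Ms) => [|? ?]; rewrite ?apps_rcons.
Qed.

Lemma wh_red_whnf_det M N N' :
  wh_red M N -> wh_red M N' -> whnf N -> whnf N' -> N = N'.
Proof.
move=> /wh_red1n r; elim: r N' => {M N} [M|M M1 N s _ IH] N' /wh_red1n.
  by case=> // M1 P' /wh_step_next s _ /whnf_next; rewrite s.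
move/wh_step_next: s => s; case=> [_ /whnf_next|M2 N'' /wh_step_next]; rewrite s //.
by case=> <- /wh_red_of1n; apply: IH.
Qed.

Lemma exposes_total M : exists v, exposes M v.
Proof.
case: (classic (exists N, wh_red M N /\ whnf N)) => [[N [r nf]]|no]; last first.
  by exists VBot; apply: ExpBot.
case: nf r => [x M' r|y Ms r]; first by exists (VLam x M'); apply: ExpLam.
by exists (VHead y Ms); apply: ExpHead.
Qed.

Lemma exposes_Lam M x M' v : wh_red M (Lam x M') -> exposes M v -> v = VLam x M'.
Proof.
move=> r ex; case: ex r => {M v} [M y N r' r|M y Ms r' r|M no r].
- by case: (wh_red_whnf_det r r' (WhnfLam _ _) (WhnfLam _ _)) => -> ->.
- by case: (apps_Var_Lam (wh_red_whnf_det r' r (WhnfVar _ _) (WhnfLam _ _))).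
- by case: no; exists (Lam x M'); split=> //; apply: WhnfLam.
Qed.

Lemma exposes_Var M y Ms v : wh_red M (apps (Var y) Ms) -> exposes M v -> v = VHead y Ms.
Proof.
move=> r ex; case: ex r => {M v} [M x N r' r|M z Ns r' r|M no r].
- by case: (apps_Var_Lam (wh_red_whnf_det r r' (WhnfVar _ _) (WhnfLam _ _))).
- by case: (apps_Var_inj (wh_red_whnf_det r r' (WhnfVar _ _) (WhnfVar _ _))) => -> ->.
- by case: no; exists (apps (Var y) Ms); split=> //; apply: WhnfVar.
Qed.

(** * The machine *)

Scheme closure_mut := Induction for closure Sort Prop
with env_mut := Induction for env Sort Prop
with entry_mut := Induction for entry Sort Prop.
Combined Scheme closure_env_entry_ind from closure_mut, env_mut, entry_mut.

Definition label_eq_dec : comparable label.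
Proof. by move=> a b; rewrite /decidable; decide equality; apply: PeanoNat.Nat.eq_dec. Defined.

HB.instance Definition _ := hasDecEq.Build label (compareP label_eq_dec).

Lemma cats2 (T : Type) (s : seq T) a b : s ++ [:: a; b] = rcons (rcons s a) b.
Proof. by rewrite -!cats1 -catA. Qed.

Lemma cat2_inj (s s' : lpath) a b a' b' :
  s ++ [:: a; b] = s' ++ [:: a'; b'] -> [/\ s = s', a = a' & b = b'].
Proof. by rewrite !cats2 => /rcons_inj [/rcons_inj [-> ->] ->]. Qed.

Lemma step_det K K1 K2 : step K K1 -> step K K2 -> K1 = K2.
Proof.
move=> s1; case: s1 K2 => {K K1}
  [u1 u2 rho S pi|x u rho c S pi alpha e|x rho S pi u' rho' t e] K2 s2;
  inversion s2 as [|? ? ? ? ? ? alpha' e'|? ? ? ? ? ? ? e']; subst=> //.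
(* The path [alpha] of a beta step is determined by the thunk path of the popped closure. *)
- by move: e'; rewrite e => /cat2_inj [-> _ _].
- by move: e'; rewrite e => -[-> -> ->].
Qed.

Lemma step_run K K1 K2 : run K K1 -> step K1 K2 -> run K K2.
Proof. by move=> r s; apply: rt_trans r _; apply: rt_step. Qed.

Lemma run1n K K' : run K K' -> clos_refl_trans_1n config step K K'.
Proof. exact: clos_rt_rt1n. Qed.

Lemma halt_det K x u rho pi x' u' rho' pi' :
  run K (Config (Lam x u) rho [::] pi) -> run K (Config (Lam x' u') rho' [::] pi') ->
  Config (Lam x u) rho [::] pi = Config (Lam x' u') rho' [::] pi'.
Proof.
move=> /run1n; move e : (Config (Lam x u) _ _ _) => H r.
elim: r e => {K H} [K <-|K K1 H s _ IH e] /run1n.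
  by move=> r; inversion r as [|K1 K2 s]; [congruence|inversion s].
move=> r; inversion r as [|K1' K2 s' r']; subst; first by inversion s.
by apply: IH => //; apply: clos_rt1n_rt; rewrite (step_det s s').
Qed.

Section Reachable.

Variable M0 : term.

(* [node pi u rho]: the instance of subterm [u] located at path [pi] has
   environment [rho]. *)
Inductive node : lpath -> term -> env -> Prop :=
| NodeRoot : node [::] M0 Empty
| NodeCallee pi u1 u2 rho :
    node pi (App u1 u2) rho -> node (pi ++ [:: Lcallee]) u1 rho
| NodeParameter pi u1 u2 rho :
    node pi (App u1 u2) rho -> node (pi ++ [:: Lcall; Lparameter]) u2 rho
| NodeCallResult pi u1 u2 rho x u rho' pi' :
    node pi (App u1 u2) rho ->
    run (Config u1 rho [::] (pi ++ [:: Lcallee])) (Config (Lam x u) rho' [::] pi') ->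
    node (pi ++ [:: Lcall; Lresult]) u
         (Bind rho' x (EClo (Clo u2 rho (pi ++ [:: Lcall; Lparameter]))))
| NodeBody pi x u rho :
    node pi (Lam x u) rho ->
    node (pi ++ [:: Lwhnf; Lresult]) u (Bind rho x (EDecl (decl_path pi))).

(** The last labels reveal the constructor and the induction hypothesis handles the prefix; at a
    call result, [halt_det] fixes the abstraction that is reached. *)
Lemma node_fun p u rho u' rho' : node p u rho -> node p u' rho' -> u = u' /\ rho = rho'.
Proof.
move=> n; elim: n u' rho' => {p u rho}
  [|pi u1 u2 rho _ IH|pi u1 u2 rho _ IH|pi u1 u2 rho x u rho1 pi1 _ IH r|pi x u rho _ IH] u' rho';
  move e : (X in node X) => p n;
  case: n e => [|pi' v1 v2 r1 n|pi' v1 v2 r1 n|pi' v1 v2 r1 y v r2 pi2 n r'|pi' y v r1 n];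
  rewrite ?cats2 ?cats1 //=;
  try (by move/(congr1 size); rewrite /= ?size_rcons);
  try by (case/rcons_inj).
- by case/rcons_inj => e; move: n; rewrite -e => /IH [[-> _] ->].
- by case/rcons_inj => /rcons_inj [] e; move: n; rewrite -e => /IH [[_ ->] ->].
- case/rcons_inj => /rcons_inj [] e; move: n r'; rewrite -e => /IH [[<- <-] <-].
  by move/(halt_det r) => [-> -> ->].
(* Call results and abstraction bodies both end in [Lresult]; the label before it tells them
   apart. *)
- by case/rcons_inj => /rcons_inj [].
- by case/rcons_inj => /rcons_inj [].
- by case/rcons_inj => /rcons_inj [] e; move: n; rewrite -e => /IH [[-> ->] ->].
Qed.

(** * Invariant of reachable configurations *)

Definition covered (u : term) (rho : env) : Prop :=
  forall x, x \in fv u -> lookup rho x <> None.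

(** An entry is checked against the environment that it extends: a declaration must come from an
    abstraction whose node has exactly this environment. *)
Fixpoint wf_closure (c : closure) : Prop :=
  let: Clo u rho t := c in [/\ node t u rho, covered u rho & wf_env rho]
with wf_env (rho : env) : Prop :=
  match rho with
  | Empty => True
  | Bind rho' x e => wf_env rho' /\ wf_entry rho' x e
  end
with wf_entry (rho : env) (x : name) (e : entry) : Prop :=
  match e with
  | EClo c => wf_closure c
  | EDecl d => exists pi u, d = decl_path pi /\ node pi (Lam x u) rho
  end.

Lemma wf_lookup rho x c : wf_env rho -> lookup rho x = Some (EClo c) -> wf_closure c.
Proof.
elim: rho => //= rho IH y e [wf wfe]; case: eqP => [_ [ee]|_]; last exact: IH.
by rewrite ee in wfe.
Qed.

(** For each stacked closure, the run since its push is recorded with the stack cut off at that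
    closure. Once it is on top, this run ends in a halting configuration, as [NodeCallResult]
    requires. *)
Definition inv (K : config) : Prop :=
  let: Config u rho stk pi := K in
  wf_closure (Clo u rho pi) /\
  forall S1 c S2, stk = S1 ++ c :: S2 ->
    wf_closure c /\
    exists alpha u1 u2 rho2,
      [/\ c = Clo u2 rho2 (alpha ++ [:: Lcall; Lparameter]),
          node alpha (App u1 u2) rho2 &
          run (Config u1 rho2 [::] (alpha ++ [:: Lcallee])) (Config u rho S1 pi)].

Lemma inv_focus_on c : wf_closure c -> inv (focus_on c).
Proof. by case: c => u rho t wf; split=> // -[]. Qed.

Lemma inv_step K K' : step K K' -> inv K -> inv K'.
Proof.
case=> {K K'} [u1 u2 rho S pi|x u rho c S pi alpha e|x rho S pi u' rho' t e] [[n cov wf] st].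
- have cov1 : covered u1 rho by move=> x xu; apply: cov; rewrite mem_cat xu.
  have cov2 : covered u2 rho by move=> x xu; apply: cov; rewrite mem_cat xu orbT.
  split; first by split=> //; apply: NodeCallee n.
  case=> [|c0 S1] c S2 [<-].
    move=> _; split; first by split=> //; apply: NodeParameter n.
    by exists pi, u1, u2, rho; split=> //; apply: rt_refl.
  case/st => wfc [al [v1 [v2 [rho2 [ec nc r]]]]]; split=> //.
  by exists al, v1, v2, rho2; split=> //; apply: step_run r _; apply: StepPush.
(* With [S1] empty, the recorded run stops at the abstraction about to be applied. *)
- have [wfc [al [v1 [v2 [rho2 [ec nc r]]]]]] := st [::] c S (erefl _).
  have eal : al = alpha by move: e; rewrite ec => /cat2_inj [].
  subst al; split.
    split=> //; first by rewrite ec; apply: NodeCallResult nc r.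
    move=> y yu /=; case: eqP => // /eqP yx; apply: cov; by rewrite mem_filter yx.
  move=> S1 c' S2 eS.
  (* For a deeper closure, the old run still has [c] on its stack, and the beta step extends it. *)
  have [wfc' [al [w1 [w2 [rho3 [ec' nc' r']]]]]] := st (c :: S1) c' S2 (congr1 (cons c) eS).
  split=> //; exists al, w1, w2, rho3; split=> //.
  by apply: step_run r' _; apply: StepBeta.
- split; first exact: wf_lookup wf e.
  move=> S1 c S2 /st [wfc [al [v1 [v2 [rho2 [ec nc r]]]]]]; split=> //.
  by exists al, v1, v2, rho2; split=> //; apply: step_run r _; apply: StepLookup.
Qed.

Lemma inv_run K K' : run K K' -> inv K -> inv K'.
Proof. by elim=> {K K'} [K K' /inv_step|K|K K' K'' _ IH _ IH' /IH /IH']. Qed.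

Lemma inv_entered x u rho pi : inv (Config (Lam x u) rho [::] pi) -> inv (entered x u rho pi).
Proof.
move=> [[n cov wf] _]; split; last by case.
split; first exact: NodeBody.
  by move=> y yu /=; case: eqP => // /eqP yx; apply: cov; rewrite mem_filter yx.
by split=> //; exists pi, u.
Qed.

Lemma inv_initial : closed_term M0 -> inv (initial M0).
Proof.
move=> cl; split; last by case.
by split=> //; [apply: NodeRoot | move=> x; rewrite cl].
Qed.

Lemma inv_progress K : inv K ->
  [\/ exists K', step K K',
      exists x u rho pi, K = Config (Lam x u) rho [::] pi
    | exists y rho S pi d, K = Config (Var y) rho S pi /\ lookup rho y = Some (EDecl d)].
Proof.
case: K => -[x|x u|u1 u2] rho S pi [[n cov wf] st].
- case e : (lookup rho x) => [[[u' rho' t]|d]|]; last by case: (cov x (mem_head _ _)).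
    by constructor 1; eexists; apply: StepLookup e.
  by constructor 3; exists x, rho, S, pi, d.
- case: S st => [|c S] st; first by constructor 2; exists x, u, rho, pi.
  have [_ [al [v1 [v2 [rho2 [ec _ _]]]]]] := st [::] c S (erefl _).
  by constructor 1; eexists; apply: (@StepBeta _ _ _ _ _ _ al); rewrite ec.
- by constructor 1; eexists; apply: StepPush.
Qed.

(** Without an observation, every configuration reached from [K] has a successor by [inv_progress];
    iterating a chosen successor gives an infinite run. *)
Lemma observes_total K : inv K -> exists v, observes K v.
Proof.
move=> iK; case: (classic (exists v, observes K v)) => // no.
have next K1 : run K K1 -> exists K2, step K1 K2.
  move=> r; case: (inv_progress (inv_run r iK)) => //.
    move=> [x [u [rho [pi e]]]]; case: no; rewrite e in r.
    by eexists; apply: ObsShape r.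
  move=> [y [rho [S [pi [d [e l]]]]]]; case: no; rewrite e in r.
  by eexists; apply: ObsHead r l.
pose nxt K1 := epsilon (inhabits K) (step K1).
have runs n : run K (iter n nxt K).
  elim: n => [|n IH]; first exact: rt_refl.
  by apply: (step_run IH); apply: epsilon_spec; apply: next.
exists VBot; apply: ObsBot; exists (fun n => iter n nxt K); split=> // n /=.
by apply: epsilon_spec; apply: next.
Qed.

(** * Sizes, and the origin of declaration instances *)

Fixpoint term_size (M : term) : nat :=
  match M with
  | Var _ => 1
  | Lam _ M' => (term_size M').+1
  | App M1 M2 => (term_size M1 + term_size M2).+1
  end.

Fixpoint closure_size (c : closure) : nat :=
  let: Clo u rho _ := c in term_size u + env_size rho
with env_size (rho : env) : nat :=
  match rho with
  | Empty => 0
  | Bind rho' _ e => (env_size rho' + entry_size e).+1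
  end
with entry_size (e : entry) : nat := if e is EClo c then closure_size c else 0.

Lemma lookup_size rho x c : lookup rho x = Some (EClo c) -> closure_size c < env_size rho.
Proof.
elim: rho => //= rho IH y e; case: eqP => [_ [->]|_ /IH] /=; lia.
Qed.

Fixpoint closure_insts (c : closure) : seq instance :=
  let: Clo u rho _ := c in env_insts rho
with env_insts (rho : env) : seq instance :=
  match rho with
  | Empty => [::]
  | Bind rho' x e => entry_insts x e ++ env_insts rho'
  end
with entry_insts (x : name) (e : entry) : seq instance :=
  match e with
  | EClo c => closure_insts c
  | EDecl d => [:: (x, d)]
  end.

(** The environment in which an instance was created is a strict part of whatever contains the
    instance. For entries the bound is the size of the environment extended by the entry. *)
Lemma insts_origin y d :
  (forall c, wf_closure c -> (y, d) \in closure_insts c -> exists rho1 pi u,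
     [/\ d = decl_path pi, node pi (Lam y u) rho1 & env_size rho1 < closure_size c]) /\
  (forall rho, wf_env rho -> (y, d) \in env_insts rho -> exists rho1 pi u,
     [/\ d = decl_path pi, node pi (Lam y u) rho1 & env_size rho1 < env_size rho]) /\
  (forall e rho x, wf_entry rho x e -> (y, d) \in entry_insts x e -> exists rho1 pi u,
     [/\ d = decl_path pi, node pi (Lam y u) rho1 &
         env_size rho1 < (env_size rho + entry_size e).+1]).
Proof.
apply: closure_env_entry_ind => //=.
- move=> u rho IH t [_ _ /IH h] /h [rho1 [pi [v [e n l]]]].
  by exists rho1, pi, v; split=> //; lia.
- move=> rho IH x e IHe [/IH h /IHe he]; rewrite mem_cat => /orP [/he //|/h].
  by move=> [rho1 [pi [v [ed n l]]]]; exists rho1, pi, v; split=> //; lia.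
- move=> c IH rho x /IH h /h [rho1 [pi [v [e n l]]]].
  by exists rho1, pi, v; split=> //; lia.
- move=> d' rho x [pi [u [-> n]]]; rewrite inE => /eqP [-> ->].
  by exists rho, pi, u; split=> //; lia.
Qed.

Lemma enter_fresh x u rho pi :
  inv (Config (Lam x u) rho [::] pi) -> (x, decl_path pi) \notin env_insts rho.
Proof.
move=> [[n _ wf] _]; apply/negP => /(proj1 (proj2 (insts_origin _ _)) _ wf).
move=> [rho1 [pi' [v [/cat2_inj [<- _ _] n' l]]]].
(* Both nodes lie at [pi], so their environments agree, against the strict inequality of sizes. *)
by case: (node_fun n n') l => _ ->; rewrite ltnn.
Qed.

End Reachable.

(** * Decoding configurations *)

(* The value in an empty environment is junk; a closed term keeps it invariant
   under shifting. *)
Fixpoint dec_closure (D : seq instance) (c : closure) : db :=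
  let: Clo u rho _ := c in tr (dec_env D rho) u
with dec_env (D : seq instance) (rho : env) : name -> db :=
  match rho with
  | Empty => fun _ => DLam (DVar 0)
  | Bind rho' x e => fun y => if y == x then dec_entry D x e else dec_env D rho' y
  end
with dec_entry (D : seq instance) (x : name) (e : entry) : db :=
  match e with
  | EClo c => dec_closure D c
  | EDecl d => DVar (index (x, d) D)
  end.

(** A new instance in front raises every index by one, including the default index [size D] of
    absent instances. *)
Lemma dec_shift v D :
  (forall c, v \notin closure_insts c -> dec_closure (v :: D) c = ren succn (dec_closure D c)) /\
  (forall rho, v \notin env_insts rho ->
     forall y, dec_env (v :: D) rho y = ren succn (dec_env D rho y)) /\
  (forall e x, v \notin entry_insts x e -> dec_entry (v :: D) x e = ren succn (dec_entry D x e)).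
Proof.
apply: closure_env_entry_ind => //=.
- by move=> u rho IH t /IH h; rewrite ren_tr; apply: tr_ext => y _.
- move=> rho IH x e IHe; rewrite mem_cat => /norP [/IHe he /IH h] y.
  by case: eqP.
- by move=> d x; rewrite inE => /negbTE ->.
Qed.

Lemma dec_lookup D rho x c : lookup rho x = Some (EClo c) -> dec_env D rho x = dec_closure D c.
Proof. by elim: rho => //= rho IH y e; case: eqP => // _ [->]. Qed.

Lemma dec_lookup_decl D rho x d :
  lookup rho x = Some (EDecl d) -> dec_env D rho x = DVar (index (x, d) D).
Proof. by elim: rho => //= rho IH y e; case: eqP => // -> [->]. Qed.

Definition dec (D : seq instance) (K : config) : db :=
  let: Config u rho stk _ := K in
  dapps (tr (dec_env D rho) u) [seq dec_closure D c | c <- stk].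

Definition insts (K : config) : seq instance :=
  let: Config _ rho stk _ := K in env_insts rho ++ flatten [seq closure_insts c | c <- stk].

Lemma lookup_insts rho x c :
  lookup rho x = Some (EClo c) -> {subset closure_insts c <= env_insts rho}.
Proof.
elim: rho => //= rho IH y e; case: eqP => [_ [->]|_ /IH h] v vc; rewrite mem_cat ?vc //.
by rewrite h ?orbT.
Qed.

Lemma lookup_decl_insts rho x d : lookup rho x = Some (EDecl d) -> (x, d) \in env_insts rho.
Proof.
elim: rho => //= rho IH y e; rewrite mem_cat.
by case: eqP => [-> [->]|_ /IH ->]; rewrite /= ?mem_head ?orbT.
Qed.

(** Declarations are created by entering only; the transitions rearrange existing closures. *)
Lemma step_insts K K' : step K K' -> {subset insts K' <= insts K}.
Proof.
case=> {K K'} [u1 u2 rho S pi|x u rho c S pi alpha e|x rho S pi u' rho' t e] v /=.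
- by rewrite !mem_cat orbA orbb.
- by rewrite !mem_cat; case: (v \in env_insts rho); rewrite ?orbT ?orbF.
- by rewrite !mem_cat => /orP [/(lookup_insts e) ->|->]; rewrite ?orbT.
Qed.

Lemma run_insts K K' : run K K' -> {subset insts K' <= insts K}.
Proof.
by elim=> {K K'} [K K' /step_insts|K|K K' K'' _ IH _ IH'] // v /IH' /IH.
Qed.

(** * Simulation of the machine by weak-head reduction *)

Definition config_size (K : config) : nat := closure_size (Clo (control K) (environment K) [::]).

Lemma step_simulation D N K K' M : step K K' -> tr (vars N) M = dec D K ->
  (tr (vars N) M = dec D K' /\ config_size K' < config_size K) \/
  exists2 M', wh_step M M' & tr (vars N) M' = dec D K'.
Proof.
case=> {K K'} [u1 u2 rho S pi|x u rho c S pi alpha e|x rho S pi u' rho' t e] eM.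
- by left; split; [rewrite eM|rewrite /config_size /=; lia].
- right; move: eM => /tr_dapps_inv [M1 [[|v Ms] [-> //= e1 [e2 e3]]]].
  case: M1 e1 => //= y b [e1].
  exists (apps (subst1 b y v) Ms); first exact: WhBeta.
  (* Substituting in the named body and binding in the environment have the same image, by
     [inst_scons_tr]. *)
  have {}e1 : tr (vars N) (subst1 b y v) = tr (dec_env D (Bind rho x (EClo c))) u.
    by rewrite tr_subst1 e1 e2 inst_scons_tr.
  rewrite -e3 -{}e1; elim/last_ind: Ms {e3} => //= Ms P IH.
  by rewrite apps_rcons map_rcons /= IH /dapps -cats1 foldl_cat.
- left; split; first by rewrite eM /= (dec_lookup _ e).
  by have /= := lookup_size e; rewrite /config_size /=; lia.
Qed.

Lemma run_simulation D N K K' M : run K K' -> tr (vars N) M = dec D K ->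
  exists2 M', wh_red M M' & tr (vars N) M' = dec D K'.
Proof.
move=> r; elim: r M => {K K'} [K K' s|K|K K' K'' _ IH _ IH'] M eM.
- case: (step_simulation s eM) => [[eM' _]|[M' s' eM']].
    by exists M => //; apply: rt_refl.
  by exists M' => //; apply: rt_step.
- by exists M => //; apply: rt_refl.
- have [M1 r1 /IH' [M2 r2 e2]] := IH _ eM.
  by exists M2 => //; apply: rt_trans r1 r2.
Qed.

Lemma diverges_step K : diverges K -> exists2 K', step K K' & diverges K'.
Proof. by move=> [r [<- h]]; exists (r 1) => //; exists (fun n => r n.+1). Qed.

(** Steps that keep the decoded term decrease [config_size], so an infinite run must reach a beta
    step. *)
Lemma diverges_wh_step D N K M : diverges K -> tr (vars N) M = dec D K ->
  exists K' M', [/\ wh_step M M', diverges K' & tr (vars N) M' = dec D K'].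
Proof.
have [n] := ubnP (config_size K); elim: n K => // n IH K lt dK eM.
have [K' s dK'] := diverges_step dK.
case: (step_simulation s eM) => [[eM' lt']|[M' s' eM']]; last by exists K', M'.
by apply: IH dK' eM'; lia.
Qed.

(** Determinism makes the divergent run follow the reduction to [P], where it would force one more
    weak-head step. *)
Lemma diverges_no_whnf D N K M P :
  diverges K -> tr (vars N) M = dec D K -> wh_red M P -> whnf P -> False.
Proof.
move=> dK eM /wh_red1n r; elim: r K dK eM => {M P} [M|M M1 P s _ IH] K dK eM nf;
  have [K' [M' [/wh_step_next s' dK' eM']]] := diverges_wh_step dK eM.
  by rewrite (whnf_next nf) in s'.
by move: s' eM'; rewrite (wh_step_next s) => -[<-] eM'; apply: IH eM' nf.
Qed.

(** * Equality of trees *)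

Lemma unfold_treeE (S V : Type) (top : S -> view S V) (s : S) :
  unfold_tree top s =
  match top s with
  | VBot => TBot
  | VLam x s' => TLam x (unfold_tree top s')
  | VHead y ss => THead y (fun i : 'I_(size ss) => unfold_tree top (tnth (in_tuple ss) i))
  end.
Proof.
(* A cofixpoint unfolds only under a match, so the tree is first rewritten as a match on itself. *)
have tree_eta (t : tree V) : t = match t with
  | TBot => TBot | TLam x t' => TLam x t' | THead y k f => THead y f end by case: t.
by rewrite [LHS]tree_eta /=; case: (top s).
Qed.

Section Coinduction.

Variables (S V T W : Type) (topS : S -> view S V) (topT : T -> view T W).
Variable R : seq (V * W) -> S -> T -> Prop.

(** Children are compared at two indices of equal value, since the two sizes are not convertible. *)
Inductive view_rel (E : seq (V * W)) : view S V -> view T W -> Prop :=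
| RelBot : view_rel E VBot VBot
| RelLam x y s t : R ((x, y) :: E) s t -> view_rel E (VLam x s) (VLam y t)
| RelHead v w ss ts :
    size ss = size ts -> binds E v w ->
    (forall (i : 'I_(size ss)) (j : 'I_(size ts)),
       i = j :> nat -> R E (tnth (in_tuple ss) i) (tnth (in_tuple ts) j)) ->
    view_rel E (VHead v ss) (VHead w ts).

Hypothesis R_top : forall E s t, R E s t -> view_rel E (topS s) (topT t).

Lemma alpha_eq_coind E s t : R E s t -> alpha_eq E (unfold_tree topS s) (unfold_tree topT t).
Proof.
move: E s t; cofix coind => E s t /R_top.
rewrite !unfold_treeE; case=> [|x y s' t' r|v w ss ts e b r].
- exact: AeqBot.
- by apply: AeqLam; apply: coind.
(* [AeqHead] wants both families over one ordinal type; eliminating [e], with [ts] seen as a tuple,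
   provides it. *)
- case: (size ts) / e (in_tuple ts) r => ts' r.
  by apply: AeqHead => // i; apply: coind; apply: r.
Qed.

End Coinduction.

(** [E] pairs the declaration instances entered so far with the binders crossed in the term; its two
    projections are the naming contexts of the two sides. *)
Definition related (M0 : term) (E : seq (instance * name)) (K : config) (M : term) : Prop :=
  [/\ inv M0 K, {subset insts K <= unzip1 E} &
      tr (vars (unzip2 E)) M = dec (unzip1 E) K].

(** First occurrences at the same position belong to the innermost pair containing either name.
    Membership of [v] excludes the default index, the length of [E]. *)
Lemma binds_index (E : seq (instance * name)) v w :
  v \in unzip1 E -> index v (unzip1 E) = index w (unzip2 E) -> binds E v w.
Proof.
elim: E => //= -[v' w'] E IH /=; rewrite inE ![_ == v]eq_sym ![_ == w]eq_sym.
case: eqP => [->|vv'] /=; first by case: eqP => // -> _ _; left.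
by case: eqP => // ww' vE [e]; right; split=> //; split=> //; apply: IH.
Qed.

Lemma related_views M0 E K M : related M0 E K M ->
  view_rel (related M0) E (epsilon (inhabits VBot) (observes K))
                          (epsilon (inhabits VBot) (exposes M)).
Proof.
move=> [iK sub eM].
have ov := epsilon_spec (inhabits VBot) _ (observes_total iK).
have ev := epsilon_spec (inhabits VBot) _ (exposes_total M).
move: (epsilon _ _) ov (epsilon _ _) ev => v1 ov v2 ev.
case: v1 / ov iK sub eM => {K} [K x u rho pi r|K y rho stk pi d r l|K dK] iK sub eM.
- have [M' r' eM'] := run_simulation r eM; have iK' := inv_run r iK.
  have sub' := run_insts r.
  (* Only an abstraction is translated to a [DLam]. *)
  case: M' eM' r' => //= y M' [eM'] /exposes_Lam /(_ ev) ->.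
  apply: RelLam; split; first exact: inv_entered.
    move=> v; rewrite /= cats0 !inE => /orP [->//|vr].
    by rewrite sub ?orbT //; apply: sub'; rewrite /= cats0.
  rewrite -tr_vars_cons eM' /=; apply: tr_ext => z _; rewrite /up eqxx.
  (* Freshness of the entered instance makes its addition to the context a plain shift. *)
  by case: eqP => // _; rewrite (proj1 (proj2 (dec_shift _ _))) // (enter_fresh iK').
- have [M' r'] := run_simulation r eM; have iK' := inv_run r iK.
  have sub' v : v \in insts (Config (Var y) rho stk pi) -> v \in unzip1 E.
    by move/(run_insts r)/sub.
  rewrite /= (dec_lookup_decl _ l) => /tr_dapps_inv [M1 [Ms [eM' e1 e2]]].
  case: M1 eM' e1 => //= w eM' [e1]; rewrite eM' in r'.
  rewrite (exposes_Var r' ev).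
  have sz : size stk = size Ms by rewrite -(size_map (tr (vars (unzip2 E)))) e2 size_map.
  apply: RelHead; first by rewrite size_map.
    by apply: binds_index; rewrite // sub' //= mem_cat (lookup_decl_insts l).
  move=> j i ij; have lt : i < size stk by rewrite sz.
  have c0 : closure by case: stk lt {r iK' sub' e2 sz j ij}.
  rewrite (tnth_nth (focus_on c0)) (tnth_nth (Var 0)) /= {}ij (nth_map c0) //.
  have ec : tr (vars (unzip2 E)) (nth (Var 0) Ms i) = dec_closure (unzip1 E) (nth c0 stk i).
    rewrite -(nth_map _ (DVar 0)) -?sz // e2.
    by rewrite (nth_map c0).
  (* Splitting the stack at [i] lets the invariant apply to the closure there. *)
  have eS : stk = take i stk ++ nth c0 stk i :: drop i.+1 stk by rewrite -drop_nth // cat_take_drop.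
  split; first by apply: inv_focus_on; case: iK' => _ /(_ _ _ _ eS) [].
    move=> v vi; apply: sub'; rewrite /= mem_cat eS map_cat flatten_cat mem_cat /= mem_cat.
    by move: vi; case: (nth c0 stk i) => ? ? ? /=; rewrite cats0 => ->; rewrite !orbT.
  by rewrite ec; case: (nth c0 stk i).
- case: v2 / ev eM => {M} [M x M' r|M y Ms r|M _] eM.
  + by case: (diverges_no_whnf dK eM r (WhnfLam _ _)).
  + by case: (diverges_no_whnf dK eM r (WhnfVar _ _)).
  + exact: RelBot.
Qed.

Theorem theoremC15 (M0 : term) (hM0 : closed_term M0) :
  alpha_eq [::] (readback (initial M0)) (LLT M0).
Proof.
apply: (alpha_eq_coind (@related_views M0)); split=> //; first exact: inv_initial.
(* The default values of [vars [::]] and [dec_env] on [Empty] differ, but a closed term consults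
   neither. *)
by apply: tr_ext => x; rewrite hM0.
Qed.
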